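(* Let $I=[a,b]$ be a compact interval, let $n\ge1$ be an integer, let $0<\alpha<1$, let $g:I\to\mathbb R$ be an arbitrary function, and let $F:I\to\mathcal K_c(\mathbb R^n)$ be $g$-Hölder of exponent $\alpha$. Then, for every $\theta\in I$ and every $x_\theta\in F(\theta)$, there exists $f:I\to\mathbb R^n$ with $f(t)\in F(t)$ for every $t\in I$ satisfying $$f(\theta)=x_\theta,\qquad[f]_{\alpha,g}\le9\Lambda_n[F]_{\alpha,g},\qquad\text{where }\Lambda_n=\frac{2\,\Gamma\left(\frac n2+1\right)}{\sqrt\pi\,\Gamma\left(\frac{n+1}2\right)}.$$
   Context: $\Gamma$ is the Euler gamma function. $\mathcal K_c(\mathbb R^n)$ is the family of nonempty compact convex subsets of Euclidean $\mathbb R^n$, with Hausdorff distance $d_H$ induced by the Euclidean norm. $F$ is $g$-Hölder of exponent $\alpha$ if there is $L\ge0$ with $d_H(F(s),F(t))\le L|g(t)-g(s)|^\alpha$ for all $s,t\in I$; $[F]_{\alpha,g}$ is the minimum such $L$. $[f]_{\alpha,g}$ is the minimum $L\ge0$ with $\|f(s)-f(t)\|\le L|g(t)-g(s)|^\alpha$ for all $s,t\in I$. *)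

(* Defs.v *)
From mathcomp Require Import all_boot all_order all_algebra.
From mathcomp Require Import all_classical all_reals all_analysis.

Set Implicit Arguments.
Unset Strict Implicit.
Unset Printing Implicit Defensive.

Import Order.TTheory GRing.Theory Num.Theory.
Import numFieldNormedType.Exports.

Local Open Scope classical_set_scope.
Local Open Scope ring_scope.

Section euler_gamma.
Context {R : realType}.

Definition euler_gamma (z : R) : R :=
  \int[@lebesgue_measure R]_(t in `]0, +oo[) (t `^ (z - 1) * expR (- t)).

Definition Lambda (n : nat) : R :=
  2 * euler_gamma (n%:R / 2 + 1) / (Num.sqrt pi * euler_gamma ((n%:R + 1) / 2)).

End euler_gamma.

Section euclidean.
Context {R : realType} {n : nat}.
Implicit Types (x y : 'rV[R]_n) (A B : set 'rV[R]_n).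

(* The library norm `|x| on 'rV[R]_n is the sup norm; it induces the same
   topology (hence the same compact sets) as l2norm, but not the same
   Hausdorff distance or Hölder constants. *)
Definition l2norm x : R := Num.sqrt (\sum_(i < n) x ord0 i ^+ 2).

Definition l2dist x y : R := l2norm (x - y).

Definition compact_convex A : Prop :=
  [/\ A !=set0, compact A & convex_set A].

Definition dist_to_set x A : R := inf [set l2dist x y | y in A].

(* sup and inf are real-valued and default to 0 outside their domain; on
   nonempty compact sets they are genuine suprema and infima. *)
Definition hausdorff_dist A B : R :=
  Num.max (sup [set dist_to_set x B | x in A])
          (sup [set dist_to_set y A | y in B]).

End euclidean.

Section holder.
Context {R : realType} {X : Type}.
Variables (d : X -> X -> R) (D : set R) (g : R -> R) (alpha : R).
Implicit Types (f : R -> X) (L : R).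

(* For 0 < alpha, 0 `^ alpha = 0, so f s and f t are at distance 0 when
   g s = g t. *)
Definition holder_bound f L : Prop :=
  0 <= L /\
  forall s t, D s -> D t -> d (f s) (f t) <= L * `|g t - g s| `^ alpha.

Definition holder f : Prop := exists L, holder_bound f L.

(* The infimum is a minimum as soon as f is Hölder (holder_constP); when f is
   not Hölder it is the junk value 0. *)
Definition holder_const f : R := inf [set L | holder_bound f L].

Lemma holder_constP f : holder f ->
  holder_bound f (holder_const f) /\
  forall L, holder_bound f L -> holder_const f <= L.
Proof.
move=> fH; have lb0 : has_lbound [set L | holder_bound f L].
  by exists 0 => L [].
split; last by move=> L fL; apply: ge_inf.
split; first by apply: lb_le_inf => // L [].
move=> s t Ds Dt; set w := _ `^ alpha.
have w0 : 0 <= w by exact: powR_ge0.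
have [w0'|wN0] := eqVneq w 0.
  by case: fH => L [_ /(_ s t Ds Dt)]; rewrite -/w w0' !mulr0.
have wgt0 : 0 < w by rewrite lt_def wN0.
rewrite -ler_pdivrMr//; apply: lb_le_inf => // L [_ /(_ s t Ds Dt)].
by rewrite -/w -ler_pdivrMr.
Qed.

End holder.

(* Main.v *)
(**
Restricting F(t) to the set G(t) of its points a with |a - x_theta| <= 2 dist(x_theta, F(t)),
one has G(theta) = {x_theta}, so any selection of G satisfies the initial
condition; moving a point towards the nearest point of F(t) to x_theta shows that
G is Hölder with constant at most (1 + 3 sqrt 3) [F] <= (31/5) [F].

Instead of the Steiner point of G(t), take a Lipschitz selection S built without
integration on the sphere.  Let X be the vector of n independent sums of m random
signs, p_A(x) a support point of A in direction x and h_A(x) = <x, p_A(x)>.  A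
discrete integration by parts shows that T(A) = E[h_A(X) X] / m is at distance
O(1/sqrt m) from E[p_A(X)], which lies in A, while the Cauchy-Schwarz inequality
shows that T is Lipschitz with constant sqrt n for the Hausdorff distance.  S(A) is
the limit of E[p_A(X)] along an ultrafilter on m.

It remains to compare sqrt n with Lambda_n.  Integrating the inequality
2 sqrt(xt) <= x + t against t^(x-1) exp(-t) gives
sqrt x Gamma(x + 1/2) <= Gamma(x + 1), hence Lambda_n >= sqrt(2n/pi) >= sqrt(n/2),
and (31/5) sqrt 2 <= 9.
*)
Require Import Defs.
From mathcomp Require Import all_boot all_order all_algebra.
From mathcomp Require Import all_classical all_reals all_analysis.
From mathcomp Require Import measurable_realfun ring lra.

Set Implicit Arguments.
Unset Strict Implicit.
Unset Printing Implicit Defensive.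

Import Order.TTheory GRing.Theory Num.Theory.
Import numFieldNormedType.Exports.

Local Open Scope classical_set_scope.
Local Open Scope ring_scope.

(** * The Euclidean norm on row vectors *)

(** Lagrange's identity: the gap between the two sides is half the sum of the squares of the minors
    [a i * b j - a j * b i]. *)
Lemma sum_cauchy_schwarz (R : realDomainType) (I : finType) (a b : I -> R) :
  (\sum_i a i * b i) ^+ 2 <= (\sum_i a i ^+ 2) * (\sum_i b i ^+ 2).
Proof.
have : 0 <= \sum_i \sum_j (a i * b j - a j * b i) ^+ 2.
  by apply: sumr_ge0 => i _; apply: sumr_ge0 => j _; exact: sqr_ge0.
suff -> : \sum_i \sum_j (a i * b j - a j * b i) ^+ 2 =
  2 * ((\sum_i a i ^+ 2) * (\sum_i b i ^+ 2) - (\sum_i a i * b i) ^+ 2).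
  by rewrite pmulr_rge0// subr_ge0.
transitivity (\sum_i \sum_j (a i ^+ 2 * b j ^+ 2 + (- 2 * ((a i * b i) * (a j * b j)) +
    b i ^+ 2 * a j ^+ 2))).
  by apply: eq_bigr => i _; apply: eq_bigr => j _; ring.
under eq_bigr do rewrite !big_split/= -!mulr_sumr.
rewrite !big_split/= -mulr_sumr -!mulr_suml; ring.
Qed.

Section euclid.
Context {R : realType} {n : nat}.
Implicit Types x y z : 'rV[R]_n.

Definition dotv x y : R := \sum_(i < n) x ord0 i * y ord0 i.

Lemma dotvC x y : dotv x y = dotv y x.
Proof. by apply: eq_bigr => i _; rewrite mulrC. Qed.

Lemma dotvDl x y z : dotv (x + y) z = dotv x z + dotv y z.
Proof. by rewrite -big_split; apply: eq_bigr => i _; rewrite !mxE mulrDl. Qed.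

Lemma dotvZl c x y : dotv (c *: x) y = c * dotv x y.
Proof. by rewrite mulr_sumr; apply: eq_bigr => i _; rewrite !mxE mulrA. Qed.

Lemma dotvDr x y z : dotv z (x + y) = dotv z x + dotv z y.
Proof. by rewrite ![dotv z _]dotvC dotvDl. Qed.

Lemma dotvZr c x y : dotv x (c *: y) = c * dotv x y.
Proof. by rewrite ![dotv x _]dotvC dotvZl. Qed.

Lemma dotvBl x y z : dotv (x - y) z = dotv x z - dotv y z.
Proof. by rewrite dotvDl -scaleN1r dotvZl mulN1r. Qed.

Lemma dotvBr x y z : dotv z (x - y) = dotv z x - dotv z y.
Proof. by rewrite ![dotv z _]dotvC dotvBl. Qed.

Lemma dotv_suml (I : finType) (F : I -> 'rV[R]_n) y :
  dotv (\sum_i F i) y = \sum_i dotv (F i) y.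
Proof.
rewrite /dotv exchange_big; apply: eq_bigr => k _.
by rewrite summxE mulr_suml.
Qed.

Lemma l2norm_ge0 x : 0 <= l2norm x.
Proof. exact: sqrtr_ge0. Qed.

Lemma sqr_l2norm x : l2norm x ^+ 2 = dotv x x.
Proof.
rewrite sqr_sqrtr; last by apply: sumr_ge0 => i _; exact: sqr_ge0.
by apply: eq_bigr => i _; rewrite expr2.
Qed.

Lemma l2norm_ub x c : 0 <= c -> dotv x x <= c ^+ 2 -> l2norm x <= c.
Proof. by move=> c0; rewrite -sqr_l2norm ler_pXn2r// nnegrE l2norm_ge0. Qed.

Lemma l2norm0 : l2norm (0 : 'rV[R]_n) = 0.
Proof. by rewrite /l2norm big1 ?sqrtr0// => i _; rewrite mxE expr0n. Qed.

Lemma l2norm_eq0 x : l2norm x = 0 -> x = 0.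
Proof.
move=> x0; apply/rowP => i; rewrite mxE; apply/eqP.
have: dotv x x == 0 by rewrite -sqr_l2norm x0 expr0n.
rewrite psumr_eq0; last by move=> j _; rewrite -expr2 sqr_ge0.
by move=> /allP/(_ i (mem_index_enum _)) /=; rewrite mulf_eq0 orbb.
Qed.

Lemma dotv_le x y : `|dotv x y| <= l2norm x * l2norm y.
Proof.
rewrite -(ler_pXn2r (_ : (0 < 2)%N))// ?nnegrE ?mulr_ge0 ?l2norm_ge0//.
rewrite real_normK ?num_real// exprMn !sqr_l2norm.
by apply: le_trans (sum_cauchy_schwarz _ _) _; rewrite /dotv; under eq_bigr do rewrite expr2;
  under [X in _ * X]eq_bigr do rewrite expr2.
Qed.

Lemma l2normD x y : l2norm (x + y) <= l2norm x + l2norm y.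
Proof.
apply: l2norm_ub; first by rewrite addr_ge0 ?l2norm_ge0.
rewrite !dotvDl !dotvDr -!sqr_l2norm (dotvC y x).
have := le_trans (ler_norm _) (dotv_le x y); lra.
Qed.

Lemma l2normZ c x : l2norm (c *: x) = `|c| * l2norm x.
Proof.
apply/eqP; rewrite -(eqrXn2 (_ : (0 < 2)%N)) ?mulr_ge0 ?l2norm_ge0//.
by rewrite exprMn real_normK ?num_real// !sqr_l2norm dotvZl dotvZr expr2 mulrA.
Qed.

Lemma l2normN x : l2norm (- x) = l2norm x.
Proof. by rewrite -scaleN1r l2normZ normrN1 mul1r. Qed.

Lemma l2normB x y : l2norm (x - y) = l2norm (y - x).
Proof. by rewrite -opprB l2normN. Qed.

Lemma l2dist_triangle x y z : l2dist x z <= l2dist x y + l2dist y z.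
Proof. by rewrite /l2dist (_ : x - z = (x - y) + (y - z)) ?l2normD// subrKA. Qed.

Lemma l2norm_coord x i : `|x ord0 i| <= l2norm x.
Proof.
rewrite -(ler_pXn2r (_ : (0 < 2)%N))// ?nnegrE ?l2norm_ge0//.
rewrite sqr_l2norm real_normK ?num_real// /dotv (bigD1 i)//= -expr2 lerDl.
by apply: sumr_ge0 => j _; rewrite -expr2 sqr_ge0.
Qed.

Lemma l2norm_le_norm x : l2norm x <= Num.sqrt n%:R * `|x|.
Proof.
apply: l2norm_ub; first by rewrite mulr_ge0 ?sqrtr_ge0.
rewrite exprMn sqr_sqrtr// mulr_natl.
apply: le_trans (_ : \sum_(i < n) `|x| ^+ 2 <= _); last first.
  by rewrite sumr_const card_ord.
apply: ler_sum => i _; rewrite -expr2 -real_normK ?num_real//.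
rewrite ler_pXn2r// ?nnegrE//.
rewrite [leRHS]mx_normrE.
by apply: le_trans (le_bigmax _ _ (ord0, i)).
Qed.

(** Bridge between the library topology, given by the sup norm, and Euclidean estimates, at the cost
    of a factor [sqrt n]. *)
Lemma near_l2norm y e : 0 < e -> \forall z \near y, l2norm (y - z) <= e.
Proof.
move=> e0.
(* Adding 1 keeps the denominator positive even for [n = 0]. *)
have s0 : 0 < Num.sqrt n%:R + 1 :> R by rewrite ltr_wpDl ?sqrtr_ge0.
have e's : 0 < e / (Num.sqrt n%:R + 1) by rewrite divr_gt0.
near=> z; apply: le_trans (l2norm_le_norm _) _.
have : `|y - z| <= e / (Num.sqrt n%:R + 1).
  near: z; apply: cvgr_dist_le e's; exact: cvg_id.
rewrite ler_pdivlMr//; have := normr_ge0 (y - z); nra.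
Unshelve. all: by end_near. Qed.

Lemma l2norm_lipschitz_continuous (f : 'rV[R]_n -> R) L :
  (forall y z, `|f y - f z| <= L * l2norm (y - z)) -> continuous f.
Proof.
move=> fL y; apply/(cvgrPdist_le (FF := nbhs_filter y)) => e e0.
have L0 : 0 < `|L| + 1 by rewrite ltr_wpDl.
near=> z; apply: le_trans (fL _ _) _.
have : l2norm (y - z) <= e / (`|L| + 1).
  by near: z; apply: near_l2norm; rewrite divr_gt0.
rewrite ler_pdivlMr//.
have := l2norm_ge0 (y - z); have := ler_norm L; nra.
Unshelve. all: by end_near. Qed.

Lemma continuous_dotv x : continuous (dotv x).
Proof.
apply: (@l2norm_lipschitz_continuous _ (l2norm x)) => y z.
by rewrite -dotvBr dotv_le.
Qed.

Lemma continuous_l2dist x : continuous (l2dist x).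
Proof.
apply: (@l2norm_lipschitz_continuous _ 1) => y z; rewrite mul1r.
have := l2dist_triangle x y z; have := l2dist_triangle x z y.
rewrite /l2dist (l2normB z y) => *; rewrite ler_norml; apply/andP; split; lra.
Qed.

End euclid.

(** * The part of a convex set close to a point *)

Section compact_convex_sets.
Context {R : realType} {n : nat}.
Implicit Types (x y a b : 'rV[R]_n) (A B : set 'rV[R]_n).

(** One half of a Hausdorff bound, with witnesses in place of suprema and infima. *)
Definition within_dist (delta : R) A B : Prop :=
  forall a, A a -> exists2 b, B b & l2dist a b <= delta.

(** A factor above 1 leaves slack proportional to the distance; this slack is what makes the
    dependence on [A] Lipschitz. *)
Definition near_part x A : set 'rV[R]_n :=
  [set a | A a /\ l2dist x a <= 2 * dist_to_set x A].

Lemma compact_convexP A a b t : compact_convex A -> A a -> A b -> 0 <= t <= 1 ->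
  A (t *: a + (1 - t) *: b).
Proof.
move=> [_ _ cA] Aa Ab t01.
have t01' : Itv.spec (@Itv.num_sem R) (Itv.Real `[0%Z, 1%Z]%O) t.
  by rewrite /Itv.spec/= /Itv.num_sem/= num_real/= in_itv.
have /= := cA a b (Itv.mk t01') (mem_set Aa) (mem_set Ab).
by rewrite inE.
Qed.

(** Induction: a mean of [N + 1] points is the convex combination, with weight [1 / (N + 1)] on the
    first point, of that point and the mean of the others. *)
Lemma compact_convex_mean A (I : eqType) (s : seq I) (F : I -> 'rV[R]_n) :
  compact_convex A -> (forall i, A (F i)) -> s != [::] ->
  A ((size s)%:R^-1 *: \sum_(i <- s) F i).
Proof.
move=> cA AF; case: s => // i0 s _.
elim: s i0 => [|j s IH] i0; first by rewrite big_seq1 invr1 scale1r.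
rewrite big_cons scalerDr /=.
set N : nat := (size s).+1.
have N0 : N%:R != 0 :> R by rewrite pnatr_eq0.
have N1 : N.+1%:R != 0 :> R by rewrite pnatr_eq0.
have e : 1 - N.+1%:R^-1 = N.+1%:R^-1 * N%:R :> R.
  by apply: (mulfI N1); rewrite mulrBr mulr1 mulfV// mulVKf// -natr1 addrK.
rewrite -(scalerKV N0 (\sum_(j <- _) _)) scalerA -e.
apply: compact_convexP => //; first exact: IH.
by rewrite invr_ge0 ler0n invf_le1 ?ltr0n// ler1n.
Qed.

Lemma dist_to_set_le x A a : A a -> dist_to_set x A <= l2dist x a.
Proof.
move=> Aa; apply: ge_inf; last by exists a.
by exists 0 => _ [b _ <-]; exact: l2norm_ge0.
Qed.

Lemma dist_to_set_attained x A : A !=set0 -> compact A ->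
  exists2 a, A a & l2dist x a = dist_to_set x A.
Proof.
move=> A0 cA.
have /(EVT_min_rV A0 cA)[c /set_mem Ac cmin] : {within A, continuous (l2dist x)}.
  exact/continuous_subspaceT/continuous_l2dist.
exists c => //; apply/eqP; rewrite eq_le dist_to_set_le// andbT.
apply: lb_le_inf; first by case: A0 => a Aa; exists (l2dist x a), a.
by move=> _ [a Aa <-]; apply: cmin; rewrite inE.
Qed.

Lemma dist_to_set_ge0 x A : 0 <= dist_to_set x A.
Proof.
have [[a Aa]|/set0P/negP/negPn/eqP ->] := pselect (A !=set0).
  by apply: lb_le_inf => [|_ [b _ <-]]; [exists (l2dist x a), a|exact: l2norm_ge0].
by rewrite /dist_to_set image_set0 inf0.
Qed.

Lemma hausdorff_dist_within A B delta : compact_convex A -> compact_convex B ->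
  hausdorff_dist A B <= delta -> within_dist delta A B.
Proof.
move=> [A0 cA _] [B0 cB _] /(le_trans _) AB a Aa.
have [b Bb ab] := dist_to_set_attained a B0 cB.
exists b => //; rewrite ab; apply: AB; rewrite le_max; apply/orP; left.
apply: ub_le_sup; last by exists a.
(* The supremum bounds its members only if they are bounded above; the distance to a fixed [b0],
   maximised over the compact [A], provides such a bound. *)
have [b0 Bb0] := B0.
have /(EVT_max_rV A0 cA)[c _ cmax] : {within A, continuous (l2dist b0)}.
  exact/continuous_subspaceT/continuous_l2dist.
exists (l2dist b0 c) => _ [a' Aa' <-].
apply: le_trans (dist_to_set_le _ Bb0) _.
by rewrite /l2dist l2normB cmax// inE.
Qed.

Lemma hausdorff_distC A B : hausdorff_dist A B = hausdorff_dist B A.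
Proof. exact: maxC. Qed.

Lemma near_part_compact_convex x A : compact_convex A -> compact_convex (near_part x A).
Proof.
move=> cA; have [A0 kA _] := cA; split.
- have [a Aa ad] := dist_to_set_attained x A0 kA.
  by exists a; split => //; rewrite ad; have := dist_to_set_ge0 x A; lra.
- rewrite (_ : near_part x A = A `&` l2dist x @^-1` [set r | r <= 2 * dist_to_set x A]) //.
  apply: compact_closedI => //; apply: closed_comp; last exact: closed_le.
  by move=> y _; exact: continuous_l2dist.
- move=> a b t /set_mem[Aa ax] /set_mem[Ab bx]; rewrite inE; split.
    by apply: set_mem; case: cA => _ _; apply; rewrite inE.
  have -> : conv t a b = t%:num *: (a : 'rV[R]_n) + (1 - t%:num) *: (b : 'rV[R]_n) by [].
  have t0 : 0 <= t%:num by [].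
  have t1 : 0 <= 1 - t%:num by rewrite subr_ge0.
  move: (t%:num) t0 t1 => {}t t0 t1.
  have -> : l2dist x (t *: a + (1 - t) *: b) =
      l2norm (t *: (x - a) + (1 - t) *: (x - b)).
    by congr l2norm; apply/rowP => i; rewrite !mxE; ring.
  apply: le_trans (l2normD _ _) _; rewrite !l2normZ !ger0_norm//.
  by move: ax bx; rewrite /l2dist; nra.
Qed.

(** The radius vanishes; this yields the initial condition at [theta]. *)
Lemma near_part_self x A : compact_convex A -> A x -> near_part x A = [set x].
Proof.
move=> cA Ax; have d0 : dist_to_set x A = 0.
  apply/eqP; rewrite eq_le dist_to_set_ge0 andbT.
  by apply: le_trans (dist_to_set_le x Ax) _; rewrite /l2dist subrr l2norm0.
apply/seteqP; split => [a [_]|_ ->]; rewrite /near_part /= d0 mulr0.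
  move=> xa; apply/esym/eqP; rewrite -subr_eq0; apply/eqP/l2norm_eq0/eqP.
  by rewrite eq_le xa l2norm_ge0.
by rewrite /l2dist subrr l2norm0.
Qed.

Lemma dist_to_set_within x A B delta : compact_convex A -> within_dist delta A B ->
  dist_to_set x B <= dist_to_set x A + delta.
Proof.
move=> [A0 cA _] AB; have [a Aa <-] := dist_to_set_attained x A0 cA.
have [b Bb ab] := AB _ Aa.
apply: le_trans (dist_to_set_le x Bb) _.
by apply: le_trans (l2dist_triangle x a b) _; rewrite lerD2l.
Qed.

(* The cruder bound [l2dist x b + l2dist x b0] for [l2dist b0 b] would give 10 in
   place of the constant 31/5 of [near_part_within], which is too much: [Lambda_ge]
   leaves room for less than 6.37 only. *)
Lemma nearest_point_pythagoras x B b0 b : compact_convex B -> B b0 -> B b ->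
  (forall c, B c -> l2dist x b0 <= l2dist x c) ->
  l2dist b0 b ^+ 2 <= l2dist x b ^+ 2 - l2dist x b0 ^+ 2.
Proof.
move=> cB Bb0 Bb bmin.
set u := x - b0; set v := b - b0.
have -> : l2dist b0 b ^+ 2 = dotv v v by rewrite /l2dist l2normB sqr_l2norm.
have uE : l2dist x b0 ^+ 2 = dotv u u by rewrite /l2dist sqr_l2norm.
have seg s : l2dist x (s *: b + (1 - s) *: b0) ^+ 2 =
    dotv u u - 2 * s * dotv u v + s ^+ 2 * dotv v v.
  rewrite /l2dist (_ : x - _ = u - s *: v); last first.
    by apply/rowP => i; rewrite !mxE; ring.
  rewrite sqr_l2norm; move: u v {uE} => u v.
  rewrite !dotvBl !dotvBr !dotvZl !dotvZr (dotvC v u); ring.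
have -> : l2dist x b ^+ 2 = dotv u u - 2 * dotv u v + dotv v v.
  by have := seg 1; rewrite scale1r subrr scale0r addr0 => ->; ring.
rewrite uE; suff : dotv u v <= 0 by lra.
rewrite leNgt; apply/negP => uv0.
have vv0 : 0 <= dotv v v by rewrite -sqr_l2norm sqr_ge0.
(* The exact minimiser [<u,v> / <v,v>] could exceed 1. This smaller [s] stays in []0, 1]] and
   satisfies [s <v,v> < <u,v>], so the quadratic [seg s] still falls below its value at 0. *)
pose s := dotv u v / (dotv u v + dotv v v).
have w0 : 0 < dotv u v + dotv v v by rewrite ltr_pwDl.
have s0 : 0 < s by rewrite divr_gt0.
have s1 : s <= 1 by rewrite ler_pdivrMr// mul1r lerDl.
have := bmin _ (compact_convexP cB Bb Bb0 (introT andP (conj (ltW s0) s1))).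
rewrite -(ler_pXn2r (_ : (0 < 2)%N)) ?nnegrE ?l2norm_ge0// seg uE.
have sE : s * (dotv u v + dotv v v) = dotv u v by rewrite divfK// gt_eqF.
nra.
Qed.

Lemma near_part_within x A B delta : 0 <= delta ->
  compact_convex A -> compact_convex B ->
  within_dist delta A B -> within_dist delta B A ->
  within_dist (31 / 5 * delta) (near_part x A) (near_part x B).
Proof.
move=> d0 cA cB AB BA a [Aa ax].
have [b Bb ab] := AB _ Aa.
have rAB := dist_to_set_within x cB BA.
have [B0 kB _] := cB.
have [b0 Bb0 b0E] := dist_to_set_attained x B0 kB.
have r0 := dist_to_set_ge0 x B.
set r := dist_to_set x B in b0E rAB r0 *.
set w := l2dist x b.
(* One [delta] comes from [a] to [b], two from the doubled change of the distance to [x]. *)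
have wle : w <= 2 * r + 3 * delta.
  by have := l2dist_triangle x a b; rewrite -/w; lra.
have [wr|rw] := leP w (2 * r).
  by exists b; [|lra].
have w2 : l2dist b0 b ^+ 2 <= w ^+ 2 - r ^+ 2.
  rewrite -b0E; apply: (nearest_point_pythagoras cB) => // c Bc.
  by rewrite b0E; exact: dist_to_set_le.
have wr0 : 0 < w - r by lra.
(* The weight solves [mu w + (1 - mu) r = 2 r], so the point pulled towards [b0] lands in the ball
   of radius [2 r]. *)
set mu := r / (w - r).
have muE : mu * (w - r) = r by rewrite divfK// gt_eqF.
have mu0 : 0 <= mu by rewrite divr_ge0// ltW.
have mu1 : mu <= 1 by rewrite ler_pdivrMr// mul1r; lra.
have Bb' : B (mu *: b + (1 - mu) *: b0) by apply: compact_convexP => //; apply/andP.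
exists (mu *: b + (1 - mu) *: b0).
  split=> //; have -> : l2dist x (mu *: b + (1 - mu) *: b0) =
      l2norm (mu *: (x - b) + (1 - mu) *: (x - b0)).
    by congr l2norm; apply/rowP => i; rewrite !mxE; ring.
  apply: le_trans (l2normD _ _) _.
  rewrite !l2normZ !ger0_norm ?subr_ge0// -/(l2dist x b) -/(l2dist x b0) b0E -/w -/r.
  nra.
apply: le_trans (l2dist_triangle a b _) _.
have -> : l2dist b (mu *: b + (1 - mu) *: b0) = (1 - mu) * l2dist b0 b.
  rewrite /l2dist (l2normB b0) -[in RHS](@ger0_norm _ (1 - mu)) ?subr_ge0//.
  by rewrite -l2normZ; congr l2norm; apply/rowP => i; rewrite !mxE; ring.
(* Here [(1 - mu) (w - r) = w - 2 r <= 3 delta]. The ratio 26/15 turns this into 26/5, and the step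
   from [a] to [b] adds 1, whence 31/5. *)
suff : (1 - mu) * l2dist b0 b <= 26 / 5 * delta by lra.
(* [(w^2 - r^2) / (w - r)^2 = (w + r) / (w - r) <= 3 <= (26/15)^2] as [2 r <= w] *)
have bb : l2dist b0 b <= 26 / 15 * (w - r).
  rewrite -(ler_pXn2r (_ : (0 < 2)%N)) ?nnegrE ?l2norm_ge0//; last by lra.
  by apply: le_trans w2 _; nra.
have := l2norm_ge0 (b0 - b); rewrite -/(l2dist b0 b) => bb0.
have : (1 - mu) * (w - r) <= 3 * delta by lra.
nra.
Qed.

End compact_convex_sets.

(** * A Lipschitz selection from sums of random signs *)

Section sign_vectors.
Context {R : realType} (n m : nat).
Local Notation Omega := {ffun 'I_n * 'I_m -> bool}.
Local Notation N := (#|{: Omega}|%:R : R).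
Implicit Types (w : Omega) (e : 'I_n * 'I_m).

Definition rsign w e : R := (-1) ^+ w e.

Definition sign_sum w : 'rV[R]_n := \row_i \sum_(j < m) rsign w (i, j).

Definition flip e w : Omega := [ffun e' => (e' == e) (+) w e'].

Lemma flipK e : involutive (flip e).
Proof. by move=> w; apply/ffunP => e'; rewrite !ffunE addKb. Qed.

Lemma rsign_flip e w : rsign (flip e w) e = - rsign w e.
Proof. by rewrite /rsign ffunE eqxx addTb signrN. Qed.

Lemma rsign_flip_neq e e' w : e' != e -> rsign (flip e w) e' = rsign w e'.
Proof. by move=> /negPf ne; rewrite /rsign ffunE ne. Qed.

Lemma sum_flip e (f : Omega -> R) : \sum_w f (flip e w) = \sum_w f w.
Proof. by rewrite [RHS](reindex_inj (can_inj (flipK e))). Qed.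

Lemma card_signs_gt0 : 0 < N.
Proof. by rewrite ltr0n; apply/card_gt0P; exists [ffun=> false]. Qed.

(** Orthogonality of the signs: for [e != e'], flipping [e] changes the sum into its opposite. *)
Lemma sum_rsignM e e' : \sum_w rsign w e * rsign w e' = N * (e == e')%:R.
Proof.
have [<-|ne] := eqVneq e e'.
  under eq_bigr do rewrite /rsign -expr2 sqrr_sign.
  by rewrite sumr_const mulr1.
apply/eqP; rewrite mulr0 -eqNr -sumrN -(sum_flip e); apply/eqP/eq_bigr => w _.
by rewrite rsign_flip rsign_flip_neq 1?eq_sym// mulNr opprK.
Qed.

(** The covariance matrix of the sign sums is [m] times the identity: off-diagonal terms vanish by
    orthogonality. *)
Lemma sum_sqr_dotv_sign_sum (z : 'rV[R]_n) :
  \sum_w dotv z (sign_sum w) ^+ 2 = N * m%:R * dotv z z.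
Proof.
have dE w : dotv z (sign_sum w) = \sum_e z ord0 e.1 * rsign w e.
  rewrite /dotv; under eq_bigr do rewrite mxE mulr_sumr.
  by rewrite pair_bigA/=; apply: eq_bigr => -[i j].
transitivity (\sum_e \sum_e' z ord0 e.1 * z ord0 e'.1 *
    \sum_w rsign w e * rsign w e').
  under eq_bigr do rewrite dE expr2 mulr_suml.
  rewrite exchange_big; apply: eq_bigr => e _ /=.
  under eq_bigr do rewrite mulr_sumr.
  rewrite exchange_big; apply: eq_bigr => e' _ /=; rewrite mulr_sumr.
  by apply: eq_bigr => w _; ring.
transitivity (\sum_(e : 'I_n * 'I_m) N * (z ord0 e.1 * z ord0 e.1)).
  apply: eq_bigr => e _; rewrite (bigD1 e)//= sum_rsignM eqxx big1 => [|e' ne].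
    by rewrite addr0 mulr1 mulrC.
  by rewrite sum_rsignM eq_sym (negPf ne) !mulr0.
rewrite -mulr_sumr -mulrA; congr (_ * _).
have <- : \sum_(i < n) \sum_(j < m) z ord0 i * z ord0 i =
    \sum_(e : 'I_n * 'I_m) z ord0 e.1 * z ord0 e.1 by rewrite pair_bigA.
by rewrite /dotv mulr_sumr; apply: eq_bigr => i _; rewrite sumr_const card_ord mulr_natl.
Qed.

Lemma sum_sqr_sign_sum i : \sum_w sign_sum w ord0 i ^+ 2 = N * m%:R.
Proof.
have dE x : dotv (delta_mx ord0 i) x = x ord0 i.
  rewrite /dotv (bigD1 i)//= mxE !eqxx mul1r big1 ?addr0// => k /negPf ki.
  by rewrite mxE ki mul0r.
have := sum_sqr_dotv_sign_sum (delta_mx ord0 i).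
by rewrite dE mxE !eqxx mulr1 => <-; apply: eq_bigr => w _; rewrite dE.
Qed.

Lemma sum_sqr_l2norm_sign_sum :
  \sum_w l2norm (sign_sum w) ^+ 2 = N * m%:R * n%:R.
Proof.
under eq_bigr do rewrite sqr_l2norm.
rewrite exchange_big/=; transitivity (\sum_(i < n) N * m%:R).
  by apply: eq_bigr => i _; rewrite -(sum_sqr_sign_sum i); under eq_bigr do rewrite -expr2.
by rewrite sumr_const card_ord [RHS]mulr_natr.
Qed.

Lemma dotv_flip i j w (a : 'rV[R]_n) :
  dotv (sign_sum w) a =
  dotv (sign_sum (flip (i, j) w)) a + 2 * rsign w (i, j) * a ord0 i.
Proof.
rewrite /dotv (bigD1 i)//= [in RHS](bigD1 i)//= !mxE.
rewrite (bigD1 j)//= [in RHS](bigD1 j)//= rsign_flip.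
have -> : \sum_(k < m | k != j) rsign (flip (i, j) w) (i, k) =
    \sum_(k < m | k != j) rsign w (i, k).
  by apply: eq_bigr => k kj; rewrite rsign_flip_neq// xpair_eqE eqxx.
have -> : \sum_(k < n | k != i) sign_sum (flip (i, j) w) ord0 k * a ord0 k =
    \sum_(k < n | k != i) sign_sum w ord0 k * a ord0 k.
  apply: eq_bigr => k ki; rewrite !mxE; congr (_ * _).
  by apply: eq_bigr => l _; rewrite rsign_flip_neq// xpair_eqE (negPf ki).
ring.
Qed.

(** A flip permutes the sample space, so nonnegativity may be checked on pairs of configurations
    differing in one sign. *)
Lemma sum_ge0_flip e (f : Omega -> R) :
  (forall w, 0 <= f w + f (flip e w)) -> 0 <= \sum_w f w.
Proof.
move=> f0; have : 0 <= \sum_w (f w + f (flip e w)) by exact: sumr_ge0.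
rewrite big_split/= sum_flip; lra.
Qed.

End sign_vectors.

(** * Averages of support points over the sign vectors *)

Section hypercube_mean.
Context {R : realType} {n : nat}.
Implicit Types (A B : set 'rV[R]_n) (p : 'rV[R]_n -> 'rV[R]_n).

(** An arbitrary choice of one support point per direction; [dotv x (p x)] is then the support
    function of [A] at [x]. *)
Definition support_selection A p :=
  forall x, A (p x) /\ forall a, A a -> dotv x a <= dotv x (p x).

Lemma support_selection_exists A : compact_convex A ->
  exists p, support_selection A p.
Proof.
move=> [A0 cA _].
suff /choice[p pP] : forall x, exists a,
    A a /\ forall b, A b -> dotv x b <= dotv x a by exists p.
move=> x; have /(EVT_max_rV A0 cA)[c /set_mem Ac cmax] : {within A, continuous (dotv x)}.
  exact/continuous_subspaceT/continuous_dotv.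
by exists c; split => // b Ab; apply: cmax; rewrite inE.
Qed.

Section fixed_size.
Variable m : nat.
Local Notation Omega := {ffun 'I_n * 'I_m -> bool}.
Local Notation N := (#|{: Omega}|%:R : R).
Local Notation X := (@sign_sum R n m).

Definition support_mean p : 'rV[R]_n := N^-1 *: \sum_(w : Omega) p (X w).

(* The discrete analogue of the representation of the Steiner point as
   the Gaussian average of [x * h_A(x)], where [h_A] is the support function. *)
Definition support_moment p : 'rV[R]_n :=
  (N * m%:R)^-1 *: \sum_(w : Omega) dotv (X w) (p (X w)) *: X w.

Lemma support_mean_in A p : compact_convex A -> support_selection A p ->
  A (support_mean p).
Proof.
move=> cA pA.
rewrite /support_mean cardE -big_enum; apply: compact_convex_mean => //.
  by move=> w; have [] := pA (X w).
by rewrite -size_eq0 -cardE -lt0n; apply/card_gt0P; exists [ffun=> false].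
Qed.

(* Averaging over one sign turns [h_A] into a difference of two of its values,
   which the support points bracket: a discrete integration by parts. *)
Lemma support_moment_flip A p i j : support_selection A p ->
  `|\sum_(w : Omega) (rsign w (i, j) * dotv (X w) (p (X w)) - p (X w) ord0 i)|
    <= \sum_(w : Omega) rsign w (i, j) * p (X w) ord0 i.
Proof.
move=> pA; rewrite ler_norml; apply/andP.
(* Each of [p (X w)] and [p (X w')] is a competitor in the maximisation defining the other. *)
have bracket w (w' := flip (i, j) w) :
    dotv (X w') (p (X w')) + 2 * rsign w (i, j) * p (X w') ord0 i <=
    dotv (X w) (p (X w)) <=
    dotv (X w') (p (X w')) + 2 * rsign w (i, j) * p (X w) ord0 i.
  have /= h1 := (pA (X w)).2 _ (pA (X w')).1.
  have /= h2 := (pA (X w')).2 _ (pA (X w)).1.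
  by rewrite -(dotv_flip i j) h1 (dotv_flip i j) lerD2r.
have sE w : rsign w (i, j) = 1 :> R \/ rsign w (i, j) = -1 :> R.
  by rewrite /rsign; case: (w (i, j)); [right; rewrite expr1|left; rewrite expr0].
split.
  rewrite lerNl -subr_ge0 -sumrN -sumrB; apply: (sum_ge0_flip (e := (i, j))) => w.
  have /andP[h1 h2] := bracket w; rewrite rsign_flip.
  by case: (sE w) h1 h2 => ->; lra.
rewrite -subr_ge0 -sumrB; apply: (sum_ge0_flip (e := (i, j))) => w.
have /andP[h1 h2] := bracket w; rewrite rsign_flip.
by case: (sE w) h1 h2 => ->; lra.
Qed.

Hypothesis m_gt0 : (0 < m)%N.

Let N0 : 0 < N. Proof. exact: card_signs_gt0. Qed.
Let m0 : 0 < m%:R :> R. Proof. by rewrite ltr0n. Qed.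

(** Summing [support_moment_flip] over [j] bounds the error [E] by [S]. As the square of a
    coordinate of [X] has mean [m], Cauchy-Schwarz gives [S <= N M sqrt m]; dividing by [N m] leaves
    [M / sqrt m]. *)
Lemma support_moment_mean_coord A p M i : support_selection A p ->
  (forall a, A a -> l2norm a <= M) ->
  (support_moment p - support_mean p) ord0 i ^+ 2 <= M ^+ 2 / m%:R.
Proof.
move=> pA AM.
set S := \sum_(w : Omega) X w ord0 i * p (X w) ord0 i.
set E := \sum_(w : Omega) (X w ord0 i * dotv (X w) (p (X w)) - m%:R * p (X w) ord0 i).
have ES : `|E| <= S.
  have -> : E = \sum_(j < m) \sum_(w : Omega)
      (rsign w (i, j) * dotv (X w) (p (X w)) - p (X w) ord0 i).
    rewrite exchange_big; apply: eq_bigr => w _ /=.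
    by rewrite mxE mulr_suml sumrB sumr_const card_ord mulr_natl.
  have -> : S = \sum_(j < m) \sum_(w : Omega) rsign w (i, j) * p (X w) ord0 i.
    by rewrite exchange_big; apply: eq_bigr => w _ /=; rewrite mxE mulr_suml.
  apply: le_trans (ler_norm_sum _ _ _) _; apply: ler_sum => j _.
  exact: support_moment_flip pA.
have -> : (support_moment p - support_mean p) ord0 i = (N * m%:R)^-1 * E.
  rewrite !mxE !summxE /E sumrB -mulr_sumr mulrBr; congr (_ - _).
    by congr (_ * _); apply: eq_bigr => w _; rewrite mxE mulrC.
  by rewrite invfM -mulrA mulKf// gt_eqF.
have S2 : S ^+ 2 <= N * m%:R * (N * M ^+ 2).
  apply: le_trans (sum_cauchy_schwarz _ _) _; rewrite sum_sqr_sign_sum.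
  rewrite ler_pM2l ?mulr_gt0//.
  have -> : N * M ^+ 2 = \sum_(w : Omega) M ^+ 2 by rewrite sumr_const mulr_natl.
  apply: ler_sum => w _; rewrite -real_normK ?num_real// ler_pXn2r ?nnegrE//.
    by apply: le_trans (l2norm_coord _ _) (AM _ _); exact: (pA _).1.
  by apply: le_trans (l2norm_ge0 (p 0)) (AM _ _); exact: (pA _).1.
have E2 : E ^+ 2 <= S ^+ 2.
  rewrite -real_normK ?num_real// ler_pXn2r ?nnegrE//.
  exact: le_trans ES.
rewrite exprMn -(@ler_pM2l _ ((N * m%:R) ^+ 2)) ?exprn_gt0 ?mulr_gt0//.
rewrite mulrA -exprMn mulfV ?gt_eqF ?mulr_gt0// expr1n mul1r.
apply: le_trans E2 (le_trans S2 _); rewrite le_eqVlt; apply/orP; left.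
by apply/eqP; field; exact: lt0r_neq0.
Qed.

Lemma support_moment_mean A p M : support_selection A p ->
  (forall a, A a -> l2norm a <= M) ->
  l2dist (support_moment p) (support_mean p) ^+ 2 <= n%:R * M ^+ 2 / m%:R.
Proof.
move=> pA AM; rewrite /l2dist sqr_l2norm.
apply: le_trans (_ : \sum_(i < n) M ^+ 2 / m%:R <= _).
  by apply: ler_sum => i _; rewrite -expr2; exact: support_moment_mean_coord pA AM.
by rewrite sumr_const card_ord -[leLHS]mulr_natl mulrA.
Qed.

(** Support functions of sets within [delta] differ by at most [delta |x|]: the point of [B] near
    [p x] competes with [q x]. *)
Lemma support_selection_within A B p q delta x :
  support_selection A p -> support_selection B q -> within_dist delta A B ->
  dotv x (p x) - dotv x (q x) <= delta * l2norm x.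
Proof.
move=> pA qB AB; have [b Bb pb] := AB _ (pA x).1.
have := (qB x).2 _ Bb.
have : dotv x (p x) - dotv x b <= l2norm x * l2dist (p x) b.
  by rewrite -dotvBr; exact: le_trans (ler_norm _) (dotv_le _ _).
have := l2norm_ge0 x; nra.
Qed.

(** The difference [z] is tested against itself: [N m |z|^2] is the sum of [D w <z, X w>].
    Cauchy-Schwarz with the second moments of [D] and [<z, X>] gives [|z|^2 <= n delta^2]. *)
Lemma support_moment_lipschitz A B p q delta :
  support_selection A p -> support_selection B q ->
  within_dist delta A B -> within_dist delta B A ->
  l2dist (support_moment p) (support_moment q) <= Num.sqrt n%:R * delta.
Proof.
move=> pA qB AB BA.
have d0 : 0 <= delta.
  by have [b _] := AB _ (pA 0).1; apply: le_trans; exact: l2norm_ge0.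
apply: l2norm_ub; first by rewrite mulr_ge0 ?sqrtr_ge0.
rewrite exprMn sqr_sqrtr//; set z := support_moment p - support_moment q.
pose D w := dotv (X w) (p (X w)) - dotv (X w) (q (X w)).
have zE : N * m%:R * dotv z z = \sum_(w : Omega) D w * dotv z (X w).
  have -> : z = (N * m%:R)^-1 *: \sum_(w : Omega) D w *: X w.
    rewrite /z /support_moment -scalerBr -sumrB.
    by congr (_ *: _); apply: eq_bigr => w _; rewrite -scalerBl.
  rewrite dotvZl mulrA mulfV ?gt_eqF ?mulr_gt0// mul1r dotv_suml.
  by apply: eq_bigr => w _; rewrite dotvZl dotvC.
have zz0 : 0 <= dotv z z by rewrite -sqr_l2norm sqr_ge0.
have D2 : \sum_(w : Omega) D w ^+ 2 <= delta ^+ 2 * (N * m%:R * n%:R).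
  rewrite -sum_sqr_l2norm_sign_sum mulr_sumr; apply: ler_sum => w _.
  rewrite -exprMn -real_normK ?num_real//.
  rewrite ler_pXn2r ?nnegrE ?mulr_ge0 ?l2norm_ge0// ler_norml; apply/andP; split.
    by rewrite lerNl opprB; exact: support_selection_within qB pA BA.
  exact: support_selection_within pA qB AB.
have : (N * m%:R * dotv z z) ^+ 2 <=
    delta ^+ 2 * (N * m%:R * n%:R) * (N * m%:R * dotv z z).
  rewrite [in leLHS]zE; apply: le_trans (sum_cauchy_schwarz _ _) _.
  rewrite sum_sqr_dotv_sign_sum ler_wpM2r// mulr_ge0// ltW// mulr_gt0//.
have [->|zn0] := eqVneq (dotv z z) 0; first by rewrite mulr_ge0 ?sqr_ge0.
have zz : 0 < N * m%:R * dotv z z by rewrite !mulr_gt0// lt_neqAle eq_sym zn0.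
rewrite expr2 ler_pM2r// (_ : _ * (_ * _) = N * m%:R * (n%:R * delta ^+ 2)); last by ring.
by rewrite ler_pM2l// mulr_gt0.
Qed.

End fixed_size.
End hypercube_mean.

(** * Passage to the limit along an ultrafilter *)

Lemma compact_convex_l2bounded (R : realType) n (A : set 'rV[R]_n) :
  compact_convex A -> exists M, forall a, A a -> l2norm a <= M.
Proof.
move=> [A0 cA _].
have /(EVT_max_rV A0 cA)[c _ cmax] : {within A, continuous (l2dist 0)}.
  exact/continuous_subspaceT/continuous_l2dist.
exists (l2dist 0 c) => a Aa.
by have := cmax a (mem_set Aa); rewrite {1}/l2dist l2normB subr0.
Qed.

Lemma ultra_fmap (T T' : Type) (f : T -> T') (U : set_system T) :
  UltraFilter U -> UltraFilter (f @ U).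
Proof.
move=> UU; split; first exact: fmap_proper_filter.
move=> G GG fUG; apply/seteqP; split => // B GB.
have [//|nB] := in_ultra_setVsetC (f @^-1` B) UU.
have : G (B `&` ~` B) by apply: filterI => //; exact: fUG.
by rewrite setICr => /filter_not_empty.
Qed.

(** Support means lie in [A], support moments are Lipschitz in [A], and the two merge as [m] grows;
    their common limit inherits both properties. *)
Lemma lipschitz_selection (R : realType) n :
  exists S : set 'rV[R]_n -> 'rV[R]_n,
    (forall A, compact_convex A -> A (S A)) /\
    forall A B delta, compact_convex A -> compact_convex B ->
      within_dist delta A B -> within_dist delta B A ->
      l2dist (S A) (S B) <= Num.sqrt n%:R * delta.
Proof.
(* The ultrafilter is fixed before the sets, so that limits for different sets can be compared at a
   common [m]. *)
have [U [UU sU]] := ultraFilterLemma (T := nat) (F := \oo) _.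
have /choice[p pP] : forall A, exists p : 'rV[R]_n -> 'rV[R]_n,
    compact_convex A -> support_selection A p.
  move=> A; have [cA|ncA] := pselect (compact_convex A); last by exists id.
  by have [p pA] := support_selection_exists cA; exists p.
(* The shift to [m.+1] avoids the division by [m = 0]. *)
pose q A m := support_mean m.+1 (p A).
have /choice[S SP] : forall A, exists a, compact_convex A -> A a /\ q A @ U --> a.
  move=> A; have [cA|ncA] := pselect (compact_convex A); last by exists 0.
  have [_ kA _] := cA.
  have qU : \forall m \near U, A (q A m).
    by apply: (@filterE _ U) => m; exact: support_mean_in cA (pP _ cA).
  have := kA; rewrite compact_ultra => /(_ _ (ultra_fmap (q A) UU) qU)[a [Aa qa]].
  by exists a.
exists S; split => [A cA|A B delta cA cB AB BA]; first by have [] := SP A cA.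
suff close e A' : 0 < e -> compact_convex A' ->
    \forall m \near U, l2dist (support_moment m.+1 (p A')) (S A') <= e.
  apply/ler_addgt0Pl => e e0.
  have [m [mA mB]] : exists m, l2dist (support_moment m.+1 (p A)) (S A) <= e / 2 /\
      l2dist (support_moment m.+1 (p B)) (S B) <= e / 2.
    apply: (@filter_ex _ U); apply: filterI; apply: close => //; exact: divr_gt0.
  have := l2dist_triangle (S A) (support_moment m.+1 (p A)) (S B).
  have := l2dist_triangle (support_moment m.+1 (p A)) (support_moment m.+1 (p B)) (S B).
  have := support_moment_lipschitz (ltn0Sn m) (pP _ cA) (pP _ cB) AB BA.
  move: mA mB; rewrite /l2dist (l2normB _ (S A)); lra.
move=> e0 cA'; have e20 : 0 < e / 2 by rewrite divr_gt0.
have [M AM] := compact_convex_l2bounded cA'.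
have [_ SA'] := SP A' cA'.
(* From [K] on, [support_moment_mean] bounds the squared distance by [(e / 2)^2]. *)
have [K nK] : exists K : nat, n%:R * M ^+ 2 / (e / 2) ^+ 2 <= K%:R.
  by exists (Num.truncn (n%:R * M ^+ 2 / (e / 2) ^+ 2)).+1; rewrite ltW// truncnS_gt.
have h1 : \forall m \near U, l2norm (S A' - q A' m) <= e / 2.
  exact: SA' (near_l2norm _ e20).
have h2 : \forall m \near U, (K <= m)%N by apply: sU; exact: nbhs_infty_ge.
apply: filterS2 h1 h2 => m h1 Km.
have := l2dist_triangle (support_moment m.+1 (p A')) (q A' m) (S A').
rewrite {3}/l2dist (l2normB (q A' m)).
suff : l2dist (support_moment m.+1 (p A')) (q A' m) <= e / 2 by lra.
rewrite -(ler_pXn2r (_ : (0 < 2)%N)) ?nnegrE ?l2norm_ge0 ?(ltW e20)//.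
apply: le_trans (support_moment_mean (ltn0Sn m) (pP _ cA') AM) _.
rewrite ler_pdivrMr ?ltr0n// [leRHS]mulrC -ler_pdivrMr ?exprn_gt0//.
by apply: le_trans nK _; rewrite ler_nat ltnW.
Qed.

(** * Comparison of the constants *)

Section gamma_half_step.
Context {R : realType}.
Implicit Types (s t x : R).
Local Notation mu := (@lebesgue_measure R).

(** The exponent is shifted: the integral over the positive half-line is the gamma function at
    [s + 1]. *)
Definition gamma_integrand s t : R := t `^ s * expR (- t).

Lemma gamma_integrand_ge0 s t : 0 <= gamma_integrand s t.
Proof. by rewrite mulr_ge0 ?powR_ge0 ?expR_ge0. Qed.

Lemma measurable_gamma_integrand s (D : set R) : measurable_fun D (gamma_integrand s).
Proof.
apply: measurable_funTS; apply: measurable_funM; first exact: measurable_powR.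
by apply: measurableT_comp => //; exact: measurableT_comp.
Qed.

Lemma is_derive_gamma_integrand s t : 0 < t ->
  is_derive t 1 (gamma_integrand s)
    (s * gamma_integrand (s - 1) t - gamma_integrand s t).
Proof.
move=> t0; have d1 := is_derive1_powR s t0.
have d2 : is_derive t 1 (fun u : R => expR (- u)) (- expR (- t)).
  by apply: is_derive_eq; rewrite mulrN1.
apply: is_derive_eq (is_deriveM d1 d2) _.
rewrite /gamma_integrand /GRing.scale/=; ring.
Qed.

Lemma gamma_integrand_within_continuous s a b : 0 < a ->
  {within `[a, b], continuous (gamma_integrand s)}.
Proof.
move=> a0; apply: derivable_within_continuous => t; rewrite in_itv/= => /andP[at_ _].
by have [] := is_derive_gamma_integrand s (lt_le_trans a0 at_).
Qed.

Lemma integrable_gamma_integrand_itv s a b : 0 < a ->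
  mu.-integrable `[a, b] (EFin \o gamma_integrand s).
Proof.
move=> a0; apply: continuous_compact_integrable; first exact: segment_compact.
exact: gamma_integrand_within_continuous.
Qed.

(** From [1 + u <= exp u] at [u = t / (2 s)] follows [t <= 2 s exp (t / (2 s))], which is raised to
    the power [s]. *)
Lemma gamma_integrand_le s t : 0 < s -> 0 <= t ->
  gamma_integrand s t <= (2 * s) `^ s * expR (- (t / 2)).
Proof.
move=> s0 t0; have s20 : 0 < 2 * s by rewrite mulr_gt0.
have -> : expR (- (t / 2)) = expR (t / 2) * expR (- t).
  by rewrite -expRD; congr expR; field.
rewrite mulrA ler_pM2r ?expR_gt0//.
have -> : (2 * s) `^ s * expR (t / 2) = (2 * s * expR (t / (2 * s))) `^ s.
  rewrite [RHS]powRM ?expR_ge0 ?ltW// -expRM; congr (_ * expR _).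
  by field; rewrite gt_eqF.
apply: ge0_ler_powR; rewrite ?nnegrE ?mulr_ge0 ?expR_ge0 ?(ltW s0) ?(ltW s20)//.
rewrite -ler_pdivrMl// mulrC; apply: le_trans (expR_ge1Dx _); lra.
Qed.

Lemma integrable_gamma_integrand s : 0 < s ->
  mu.-integrable `]0, +oo[ (EFin \o gamma_integrand s).
Proof.
(* The leading 2 cancels the factor 1/2 of the exponential density of rate 1/2. *)
move=> s0; pose C := 2 * (2 * s) `^ s.
have pdfi : mu.-integrable `]0, +oo[ (fun t => C%:E * (exponential_pdf 2^-1 t)%:E)%E.
  apply: integrableZl => //; apply: (@integrableS _ _ _ _ setT) => //.
  by apply: integrable_exponential_pdf; rewrite invr_gt0.
apply: le_integrable pdfi => //.
  by apply/measurable_EFinP; exact: measurable_gamma_integrand.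
move=> t /=; rewrite in_itv/= andbT => t0; rewrite lee_fin.
rewrite exponential_pdfE ?(ltW t0)// ger0_norm ?gamma_integrand_ge0//.
apply: le_trans (gamma_integrand_le s0 (ltW t0)) _.
apply: le_trans (ler_norm _); rewrite /C mulNr (mulrC 2^-1 t).
by rewrite le_eqVlt; apply/orP; left; apply/eqP; field.
Qed.

(** The functional equation of gamma with boundary terms. Staying away from 0 avoids the singularity
    of [t^(x-1)] when [x < 1]. *)
Lemma integral_gamma_integrand_by_parts x a b : 0 < a -> a < b ->
  x * (\int[mu]_(t in `[a, b]) gamma_integrand (x - 1) t) =
  \int[mu]_(t in `[a, b]) gamma_integrand x t + gamma_integrand x b - gamma_integrand x a.
Proof.
move=> a0 ab; set f := fun t => x * gamma_integrand (x - 1) t - gamma_integrand x t.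
have gi s := integrable_gamma_integrand_itv s b a0.
have : (\int[mu]_(t in `[a, b]) (f t)%:E =
    (gamma_integrand x b)%:E - (gamma_integrand x a)%:E)%E.
  have dF t : t \in `[a, b] -> derivable (gamma_integrand x) t 1 .
    rewrite in_itv/= => /andP[at_ _].
    by have [] := is_derive_gamma_integrand x (lt_le_trans a0 at_).
  apply: continuous_FTC2 => //.
  - move=> t; apply: cvgB.
      by apply: cvgMl_tmp; exact: gamma_integrand_within_continuous.
    exact: gamma_integrand_within_continuous.
  - have /(continuous_within_itvP _ ab)[_ ca cb] :=
      @gamma_integrand_within_continuous x a b a0.
    split => // t tab; apply: dF; exact: subset_itv_oo_cc.
  - move=> t; rewrite in_itv/= => /andP[at_ _].
    have [_] := is_derive_gamma_integrand x (lt_trans a0 at_).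
    by rewrite derive1E.
move=> /(congr1 fine); rewrite -EFinB [RHS]/= => fE.
have : \int[mu]_(t in `[a, b]) f t = gamma_integrand x b - gamma_integrand x a by [].
rewrite /f RintegralB//; last first.
  by apply: (integrableZl _ x (gi (x - 1))).
rewrite RintegralZl//; lra.
Qed.

Lemma gamma_integrand_half_step x t : 0 < x -> 0 < t ->
  2 * Num.sqrt x * gamma_integrand (x - 2^-1) t <=
  gamma_integrand x t + x * gamma_integrand (x - 1) t.
Proof.
move=> x0 t0; rewrite /gamma_integrand.
have tE y : t `^ y = t `^ (y - (x - 1)) * t `^ (x - 1).
  by rewrite -powRD ?subrK// (gt_eqF t0) implybT.
rewrite (tE x) (tE (x - 2^-1)).
have -> : x - (x - 1) = 1 by ring.
have -> : x - 2^-1 - (x - 1) = 2^-1 by field.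
rewrite powRr1 ?(ltW t0)// powR12_sqrt ?(ltW t0)//.
rewrite !mulrA -mulrDl ler_pM2r ?expR_gt0// -mulrDl ler_pM2r ?powR_gt0//.
have := sqr_ge0 (Num.sqrt x - Num.sqrt t).
rewrite sqrrB !sqr_sqrtr ?(ltW x0) ?(ltW t0)//; lra.
Qed.

Lemma cvg_gamma_integrand x : 0 < x -> gamma_integrand x k.+2%:R @[k --> \oo] --> 0.
Proof.
move=> x0; set C := (2 * x) `^ x.
have hC : C * 2 * harmonic k @[k --> \oo] --> 0.
  by rewrite -[X in _ --> X](mulr0 (C * 2)); apply: cvgMl_tmp; exact: cvg_harmonic.
apply: (@squeeze_cvgr _ _ _ _ (cst 0) (fun k => C * 2 * harmonic k)) => //; last exact: cvg_cst.
apply: nearW => k; rewrite gamma_integrand_ge0/=.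
apply: le_trans (gamma_integrand_le x0 (ler0n _ _)) _.
rewrite -mulrA ler_wpM2l ?powR_ge0//.
rewrite (_ : 2 * _ = (k.+1%:R / 2)^-1); last by rewrite invf_div.
rewrite expRN lef_pV2 ?posrE ?expR_gt0 ?divr_gt0//.
apply: le_trans (expR_ge1Dx _); rewrite -natr1; lra.
Qed.

(** The half-step inequality is integrated over compact intervals, the integral with exponent
    [x - 1] is removed by parts, and monotone convergence concludes. Extended reals make finiteness
    of the left side part of the result, also for [x <= 1/2]. *)
Lemma integral_gamma_half_step x : 0 < x ->
  (\int[mu]_(t in `]0%R, +oo[) (gamma_integrand (x - 2^-1) t)%:E <=
   ((Num.sqrt x)^-1 * \int[mu]_(t in `]0%R, +oo[) gamma_integrand x t)%:E)%E.
Proof.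
move=> x0; set G := \int[mu]_(t in _) gamma_integrand x t.
(* Starting at 2 makes every interval nondegenerate. *)
pose I (k : nat) : set R := `[k.+2%:R^-1, k.+2%:R]%classic.
have sx : 0 < Num.sqrt x by rewrite sqrtr_gt0.
have UI : \bigcup_k I k = `]0, +oo[%classic.
  apply/seteqP; split => [t [k _]|t]; rewrite /I/= !in_itv/= ?andbT.
    by move=> /andP[+ _]; apply: lt_le_trans; rewrite invr_gt0.
  move=> t0; exists (maxn (Num.truncn t) (Num.truncn t^-1)) => //=.
  rewrite in_itv/=; apply/andP; split.
    rewrite invf_ple ?posrE ?ltr0n//; apply: le_trans (ltW (truncnS_gt _)) _.
    by rewrite ler_nat ltnS leqW// leq_maxr.
  apply: le_trans (ltW (truncnS_gt _)) _.
  by rewrite ler_nat ltnS leqW// leq_maxl.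
have ndI : nondecreasing_seq I.
  move=> k l kl; apply/subsetPset/subset_itv; rewrite bnd_simp.
    by rewrite lef_pV2 ?posrE ?ltr0n// ler_nat !ltnS.
  by rewrite ler_nat !ltnS.
have Ibound k : (\int[mu]_(t in I k) (gamma_integrand (x - 2^-1) t)%:E <=
    ((Num.sqrt x)^-1 * (G + gamma_integrand x k.+2%:R))%:E)%E.
  have a0 : 0 < k.+2%:R^-1 :> R by rewrite invr_gt0.
  have ab : k.+2%:R^-1 < k.+2%:R :> R.
    apply: (@lt_trans _ _ 1); first by rewrite invf_lt1// ltr1n.
    by rewrite ltr1n.
  have gi s : mu.-integrable (I k) (EFin \o gamma_integrand s).
    exact: integrable_gamma_integrand_itv.
  have mI : measurable (I k : set (measurableTypeR R)) by exact: measurable_itv.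
  have gx1 : mu.-integrable (I k) (EFin \o (fun t => x * gamma_integrand (x - 1) t)).
    by apply: (integrableZl mI x (gi (x - 1))).
  have gh : mu.-integrable (I k)
      (EFin \o (fun t => 2 * Num.sqrt x * gamma_integrand (x - 2^-1) t)).
    by apply: (integrableZl mI (2 * Num.sqrt x) (gi (x - 2^-1))).
  rewrite -[leLHS]fineK ?integrable_fin_num//; last exact: gi.
  rewrite lee_fin -/(Rintegral mu (I k) (gamma_integrand (x - 2^-1))).
  have le1 : \int[mu]_(t in I k) (2 * Num.sqrt x * gamma_integrand (x - 2^-1) t) <=
      \int[mu]_(t in I k) (gamma_integrand x t + x * gamma_integrand (x - 1) t).
    apply: le_Rintegral => //.
      exact: (integrableD mI (gi x) gx1).
    move=> t; rewrite /I/= in_itv/= => /andP[/(lt_le_trans a0) t0 _].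
    exact: gamma_integrand_half_step.
  move: le1; rewrite RintegralZl//.
  rewrite RintegralD//.
  rewrite RintegralZl//.
  rewrite integral_gamma_integrand_by_parts//.
  have le2 : \int[mu]_(t in I k) gamma_integrand x t <= G.
    apply: fine_le.
    - by apply: integrable_fin_num => //; exact: gi.
    - by apply: integrable_fin_num => //; exact: integrable_gamma_integrand.
    - apply: ge0_subset_integral => //.
      + by apply/measurable_EFinP; exact: measurable_gamma_integrand.
      + by move=> t _; rewrite lee_fin gamma_integrand_ge0.
      + by rewrite -UI; exact: bigcup_sup.
  (* The lower boundary term enters negatively and is dropped; the upper one is kept and tends to
     0. *)
  rewrite -/(I k) => le3; rewrite [leRHS]mulrC ler_pdivlMr//.
  have := gamma_integrand_ge0 x k.+2%:R^-1.
  have := gamma_integrand_ge0 x k.+2%:R.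
  by move: le2 le3; nra.
have lhs := @ge0_nondecreasing_set_cvg_integral _ (measurableTypeR R) R I
  (EFin \o gamma_integrand (x - 2^-1)) mu ndI.
have rhs : ((Num.sqrt x)^-1 * (G + gamma_integrand x k.+2%:R))%:E @[k --> \oo]
    --> ((Num.sqrt x)^-1 * G)%:E.
  apply: cvg_EFin; first exact: nearW.
  apply: cvgMl_tmp; rewrite -[X in _ --> X]addr0; apply: cvgD; first exact: cvg_cst.
  exact: cvg_gamma_integrand.
rewrite -UI.
apply: (lee_cvg_to (lhs _ _ _) rhs) => //.
- by move=> k; exact: measurable_itv.
- by move=> k; apply/measurable_EFinP; exact: measurable_gamma_integrand.
- by move=> k t _; rewrite lee_fin gamma_integrand_ge0.
- exact: nearW.
Qed.

(** On [[1, 2]] the integrand is at least [exp (-2)]. This gives the positive denominator of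
    [Lambda]. *)
Lemma integral_gamma_integrand_gt0 s : 0 <= s ->
  (0 < \int[mu]_(t in `]0%R, +oo[) (gamma_integrand s t)%:E)%E.
Proof.
move=> s0; have m12 : measurable (`[1, 2]%classic : set (measurableTypeR R)).
  exact: measurable_itv.
apply: (@lt_le_trans _ _ (\int[mu]_(t in `[1%R, 2%R]) (expR (- 2))%:E)%E).
  rewrite integral_cst//= lebesgue_measure_itv/= lte_fin ltr1n/= -EFinB -EFinM lte_fin.
  by rewrite mulr_gt0 ?expR_gt0//; lra.
apply: (@le_trans _ _ (\int[mu]_(t in `[1%R, 2%R]) (gamma_integrand s t)%:E)%E).
  apply: ge0_le_integral => //.
  - by apply/measurable_EFinP; exact: measurable_gamma_integrand.
  - move=> t; rewrite /= in_itv/= => /andP[t1 t2]; rewrite lee_fin.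
    rewrite -[leLHS]mul1r ler_pM ?expR_ge0 ?ler_expR ?lerN2//.
    have -> : 1 = 1 `^ s :> R by rewrite powR1.
    by rewrite ge0_ler_powR ?nnegrE// (le_trans _ t1).
apply: ge0_subset_integral => //.
- by apply/measurable_EFinP; exact: measurable_gamma_integrand.
- by move=> t _; rewrite lee_fin gamma_integrand_ge0.
- by move=> t; rewrite /= !in_itv/= andbT => /andP[/(lt_le_trans ltr01)].
Qed.

Lemma Lambda_ge n : (1 <= n)%N -> 31 / 5 * Num.sqrt n%:R <= 9 * Lambda n :> R.
Proof.
move=> n1; have [x xE] : exists x : R, n%:R / 2 = x by exists (n%:R / 2).
have n1' : 1 <= n%:R :> R by rewrite ler1n.
have x0 : 0 < x by rewrite -xE divr_gt0// (lt_le_trans _ n1').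
(* Squared, this is [(31/5)^2 pi <= 162] times [n], for which [pi < 4] suffices. *)
have key : 31 / 5 * Num.sqrt n%:R * Num.sqrt pi <= 18 * Num.sqrt x.
  rewrite -(ler_pXn2r (_ : (0 < 2)%N)) ?nnegrE ?mulr_ge0 ?sqrtr_ge0//.
  rewrite !exprMn !sqr_sqrtr ?pi_ge0 ?(ltW x0)// -xE.
  have := @pihalf_lt2 R.
  rewrite -subr_gt0 => /ltW/(mulr_ge0 (le_trans ler01 n1')); lra.
have Q_E : euler_gamma (x + 1) = \int[mu]_(t in `]0, +oo[) gamma_integrand x t.
  by rewrite /euler_gamma addrK.
have P_E : euler_gamma ((n%:R + 1) / 2) =
    \int[mu]_(t in `]0, +oo[) gamma_integrand (x - 2^-1) t.
  by rewrite /euler_gamma (_ : (n%:R + 1) / 2 - 1 = x - 2^-1)// -xE; field.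
rewrite /Lambda xE Q_E P_E /Rintegral {Q_E P_E}.
have J0 : (0 < \int[mu]_(t in `]0%R, +oo[) (gamma_integrand (x - 2^-1) t)%:E)%E.
  by apply: integral_gamma_integrand_gt0; rewrite -xE; lra.
have := integral_gamma_half_step x0; rewrite /Rintegral.
(* Positivity excludes the value [-oo] and the half-step bound excludes [+oo], leaving a real
   [P]. *)
set Q := fine _; move: J0; case: (integral _ _ _) => [P| |]//=.
rewrite lte_fin lee_fin => P0 PQ.
have sx : 0 < Num.sqrt x by rewrite sqrtr_gt0.
have sp : 0 < Num.sqrt pi :> R by rewrite sqrtr_gt0 pi_gt0.
have {}PQ : Num.sqrt x * P <= Q by rewrite -ler_pdivlMl.
rewrite mulrA ler_pdivlMr ?mulr_gt0//.
rewrite [leLHS]mulrA; apply: (@le_trans _ _ (18 * Num.sqrt x * P)); last by lra.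
by rewrite ler_pM2r.
Qed.

End gamma_half_step.

(** * The selection through the prescribed point *)

Theorem theorem11p4 (R : realType) (a b : R) (leab : a <= b)
  (n : nat) (n_ge1 : (1 <= n)%N)
  (alpha : R) (alpha_gt0 : 0 < alpha) (alpha_lt1 : alpha < 1)
  (g : R -> R) (F : R -> set 'rV[R]_n)
  (FK : forall t, t \in `[a, b] -> compact_convex (F t))
  (FH : holder hausdorff_dist `[a, b] g alpha F)
  (theta : R) (thetaI : theta \in `[a, b])
  (xtheta : 'rV[R]_n) (xthetaF : F theta xtheta) :
  exists f : R -> 'rV[R]_n,
    [/\ forall t, t \in `[a, b] -> F t (f t),
        f theta = xtheta,
        holder l2dist `[a, b] g alpha f &
        holder_const l2dist `[a, b] g alpha f
          <= 9 * Lambda n * holder_const hausdorff_dist `[a, b] g alpha F].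
Proof.
have [S [SA Slip]] := lipschitz_selection R n.
(* The Hölder constant of [F] is attained, so it serves directly as [L]. *)
have [[L0 FL] _] := holder_constP FH.
set L := holder_const hausdorff_dist _ _ _ _ in L0 FL *.
pose f t := S (near_part xtheta (F t)).
have fF t : t \in `[a, b] -> near_part xtheta (F t) (f t).
  by move=> tI; apply: SA; apply: near_part_compact_convex; exact: FK.
have fL : holder_bound l2dist `[a, b] g alpha f (Num.sqrt n%:R * (31 / 5) * L).
  split=> [|s t sI tI]; first by rewrite !mulr_ge0 ?sqrtr_ge0.
  set w := _ `^ alpha; have w0 : 0 <= w by exact: powR_ge0.
  have -> : Num.sqrt n%:R * (31 / 5) * L * w = Num.sqrt n%:R * (31 / 5 * (L * w)) by ring.
  have Lw0 : 0 <= L * w by rewrite mulr_ge0.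
  have [cs ct] := (FK s sI, FK t tI).
  have st := hausdorff_dist_within cs ct (FL s t sI tI).
  have ts : within_dist (L * w) (F t) (F s).
    by apply: hausdorff_dist_within => //; rewrite hausdorff_distC; exact: FL.
  by apply: Slip; [exact: near_part_compact_convex..| |]; exact: near_part_within.
exists f; split.
- by move=> t /fF[].
- by have := fF _ thetaI; rewrite near_part_self//; exact: FK.
- by exists (Num.sqrt n%:R * (31 / 5) * L).
apply: (@le_trans _ _ (Num.sqrt n%:R * (31 / 5) * L)).
  (* The constant of [f] is an infimum of a set bounded below by 0, hence at most any admissible
     bound. *)
  by apply: ge_inf => //; exists 0 => L' [].
by rewrite ler_wpM2r// mulrC Lambda_ge.
Qed.
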